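(* Let $a<b$, $c<d$ and let $Q$ be the polynomial parameters of a 011-PI operator $\mathcal P[Q]$ on $\mathbb R^{n_0}\times L_2^{n_1}[a,b]\times L_2^{n_1}[c,d]$, with $Q_{xx}=\{Q_{xx}^0,Q_{xx}^1,Q_{xx}^1\}$ and $Q_{yy}=\{Q_{yy}^0,Q_{yy}^1,Q_{yy}^1\}$ (separable). Suppose that for some $q\in\mathbb N$, some $\mathbb R^{q\times n_1}$-valued function $Z$, square-integrable on $[a,b]$ and on $[c,d]$, and some matrices $H_{0x},H_{0y}\in\mathbb R^{n_0\times q}$, $H_{x0},H_{y0}\in\mathbb R^{q\times n_0}$, $\Gamma_{xx},\Gamma_{xy},\Gamma_{yx},\Gamma_{yy}\in\mathbb R^{q\times q}$, $$\begin{gathered}Q_{0x}(x)=H_{0x}Z(x),\quad Q_{0y}(y)=H_{0y}Z(y),\quad Q_{x0}(x)=Z^T(x)H_{x0},\quad Q_{y0}(y)=Z^T(y)H_{y0},\\ Q_{xx}^1(x,\theta)=Z^T(x)\Gamma_{xx}Z(\theta),\quad Q_{xy}(x,y)=Z^T(x)\Gamma_{xy}Z(y),\\ Q_{yx}(x,y)=Z^T(y)\Gamma_{yx}Z(x),\quad Q_{yy}^1(y,\nu)=Z^T(y)\Gamma_{yy}Z(\nu).\end{gathered}$$ Assume that $Q_{00}$, $Q_{xx}^0(x)$ for every $x\in[a,b]$, $Q_{yy}^0(y)$ for every $y\in[c,d]$, and the matrices $\Sigma_x$, $\Sigma_y$, $\Sigma_x-K_{xx}\Pi_{xy}\mathrm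 E_{yx}$, $\Sigma_y-K_{yy}\Pi_{yx}\mathrm E_{xy}$ defined in the context are invertible. Let $\hat Q=\mathcal L_{\mathrm{inv}}(Q)$ be the parameters defined in the context. Then for any $u\in\mathbb R^{n_0}\times L_2^{n_1}[a,b]\times L_2^{n_1}[c,d]$, $$(\mathcal P[\hat Q]\circ\mathcal P[Q])u=(\mathcal P[Q]\circ\mathcal P[\hat Q])u=u.$$
   Context: 011-PI operators: parameters $Q$ consist of $Q_{00}\in\mathbb R^{n_0\times n_0}$, $Q_{0x}(x),Q_{0y}(y)\in\mathbb R^{n_0\times n_1}$, $Q_{x0}(x),Q_{y0}(y)\in\mathbb R^{n_1\times n_0}$, $Q_{xy}(x,y),Q_{yx}(x,y)\in\mathbb R^{n_1\times n_1}$, and $Q_{xx}=\{Q_{xx}^0(x),Q_{xx}^1(x,\theta),Q_{xx}^2(x,\theta)\}$, $Q_{yy}=\{Q_{yy}^0(y),Q_{yy}^1(y,\nu),Q_{yy}^2(y,\nu)\}$ ($\mathbb R^{n_1\times n_1}$-valued), for $x,\theta\in[a,b]$, $y,\nu\in[c,d]$. For separable parameters ($Q_{xx}^2=Q_{xx}^1$, $Q_{yy}^2=Q_{yy}^1$), the operator $\mathcal P[Q]$ maps $(u_0,u_1,u_2)$ to $(v_0,v_1,v_2)$ with $v_0=Q_{00}u_0+\int_a^bQ_{0x}(x)u_1(x)dx+\int_c^dQ_{0y}(y)u_2(y)dy$, $v_1(x)=Q_{x0}(x)u_0+Q_{xx}^0(x)u_1(x)+\int_a^bQ_{xx}^1(x,\theta)u_1(\theta)d\theta+\int_c^dQ_{xy}(x,y)u_2(y)dy$,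 $v_2(y)=Q_{y0}(y)u_0+\int_a^bQ_{yx}(x,y)u_1(x)dx+Q_{yy}^0(y)u_2(y)+\int_c^dQ_{yy}^1(y,\nu)u_2(\nu)d\nu$. Definition of $\hat Q=\mathcal L_{\mathrm{inv}}(Q)$ (with $\hat Q_{xx}=\{\hat Q_{xx}^0,\hat Q_{xx}^1,\hat Q_{xx}^1\}$, $\hat Q_{yy}=\{\hat Q_{yy}^0,\hat Q_{yy}^1,\hat Q_{yy}^1\}$): $\hat Q_{xx}^0(x)=[Q_{xx}^0(x)]^{-1}$, $\hat Q_{yy}^0(y)=[Q_{yy}^0(y)]^{-1}$; $K_{xx}=\int_a^bZ(x)\hat Q_{xx}^0(x)Z^T(x)dx$, $K_{yy}=\int_c^dZ(y)\hat Q_{yy}^0(y)Z^T(y)dy$; $\Pi_{xx}=\Gamma_{xx}-H_{x0}Q_{00}^{-1}H_{0x}$, $\Pi_{xy}=\Gamma_{xy}-H_{x0}Q_{00}^{-1}H_{0y}$, $\Pi_{yx}=\Gamma_{yx}-H_{y0}Q_{00}^{-1}H_{0x}$, $\Pi_{yy}=\Gamma_{yy}-H_{y0}Q_{00}^{-1}H_{0y}$; $\Sigma_x=I_q+K_{xx}\Pi_{xx}$, $\Sigma_y=I_q+K_{yy}\Pi_{yy}$, $\mathrm E_{xy}=\Sigma_x^{-1}K_{xx}\Pi_{xy}$, $\mathrm E_{yx}=\Sigma_y^{-1}K_{yy}\Pi_{yx}$; $\hat\Gamma_{yx}=-(\Pi_{yx}-\Pi_{yy}\mathrm E_{yx})(\Sigma_x-K_{xx}\Pi_{xy}\mathrm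 E_{yx})^{-1}$, $\hat\Gamma_{xy}=-(\Pi_{xy}-\Pi_{xx}\mathrm E_{xy})(\Sigma_y-K_{yy}\Pi_{yx}\mathrm E_{xy})^{-1}$; $\hat\Gamma_{yy}=-(\Pi_{yy}+\hat\Gamma_{yx}K_{xx}\Pi_{xy})\Sigma_y^{-1}$, $\hat\Gamma_{xx}=-(\Pi_{xx}+\hat\Gamma_{xy}K_{yy}\Pi_{yx})\Sigma_x^{-1}$; $\hat H_{y0}=-(H_{y0}+\hat\Gamma_{yy}K_{yy}H_{y0}+\hat\Gamma_{yx}K_{xx}H_{x0})Q_{00}^{-1}$, $\hat H_{x0}=-(H_{x0}+\hat\Gamma_{xx}K_{xx}H_{x0}+\hat\Gamma_{xy}K_{yy}H_{y0})Q_{00}^{-1}$; $\hat H_{0y}=-(Q_{00}^{-1}H_{0y}-Q_{00}^{-1}H_{0x}\mathrm E_{xy})(\Sigma_y-K_{yy}\Pi_{yx}\mathrm E_{xy})^{-1}$, $\hat H_{0x}=-(Q_{00}^{-1}H_{0x}+\hat H_{0y}K_{yy}\Pi_{yx})\Sigma_x^{-1}$; $\hat Q_{00}=(I_{n_0}-\hat H_{0x}K_{xx}H_{x0}-\hat H_{0y}K_{yy}H_{y0})Q_{00}^{-1}$; $\hat Q_{0x}(x)=\hat H_{0x}Z(x)\hat Q_{xx}^0(x)$, $\hat Q_{0y}(y)=\hat H_{0y}Z(y)\hat Q_{yy}^0(y)$, $\hat Q_{x0}(x)=\hat Q_{xx}^0(x)Z^T(x)\hat H_{x0}$, $\hat Q_{y0}(y)=\hat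 Q_{yy}^0(y)Z^T(y)\hat H_{y0}$; $\hat Q_{xx}^1(x,\theta)=\hat Q_{xx}^0(x)Z^T(x)\hat\Gamma_{xx}Z(\theta)\hat Q_{xx}^0(\theta)$, $\hat Q_{xy}(x,y)=\hat Q_{xx}^0(x)Z^T(x)\hat\Gamma_{xy}Z(y)\hat Q_{yy}^0(y)$, $\hat Q_{yx}(x,y)=\hat Q_{yy}^0(y)Z^T(y)\hat\Gamma_{yx}Z(x)\hat Q_{xx}^0(x)$, $\hat Q_{yy}^1(y,\nu)=\hat Q_{yy}^0(y)Z^T(y)\hat\Gamma_{yy}Z(\nu)\hat Q_{yy}^0(\nu)$. *)

(* Defs.v *)
(* MathComp-Analysis, over an arbitrary R : realType. *)
From HB Require Import structures.
From mathcomp Require Export all_boot all_order all_algebra.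
From mathcomp Require Export all_classical all_reals all_analysis.

Set Implicit Arguments.
Unset Strict Implicit.
Unset Printing Implicit Defensive.

Import Order.TTheory GRing.Theory Num.Theory.

Local Open Scope classical_set_scope.
Import numFieldNormedType.Exports.
Local Open Scope ring_scope.

Section MatrixFunctions.
Variables (R : realType) (m n : nat).

Definition mxint (s t : R) (F : R -> 'M[R]_(m, n)) : 'M[R]_(m, n) :=
  \matrix_(i, j) Rintegral (@lebesgue_measure R) `[s, t] (fun x => F x i j).

(* [f \_ D] is the extension of [f] by zero outside [D]; only the values of
   [F] on [s, t] matter. *)
Definition square_integrable (s t : R) (F : R -> 'M[R]_(m, n)) : Prop :=
  forall i j,
    (fun x => F x i j) \_ `[s, t] \in Lfun (@lebesgue_measure R) 2%:E.

Definition ae_eq_on (s t : R) (F G : R -> 'M[R]_(m, n)) : Prop :=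
  {ae @lebesgue_measure R, forall x, x \in `[s, t] -> F x = G x}.

Definition polynomial_on (s t : R) (F : R -> 'M[R]_(m, n)) : Prop :=
  exists P : 'M[{poly R}]_(m, n),
    forall x, x \in `[s, t] -> F x = \matrix_(i, j) (P i j).[x].

Definition polynomial2_on (s t s' t' : R) (F : R -> R -> 'M[R]_(m, n)) :
    Prop :=
  exists P : 'M[{poly {poly R}}]_(m, n),
    forall x y, x \in `[s, t] -> y \in `[s', t'] ->
      F x y = \matrix_(i, j) (P i j).[y%:P].[x].

End MatrixFunctions.

(* Representatives of elements of R^n0 * L_2^n1[a, b] * L_2^n1[c, d]. *)
Record state (R : realType) (n0 n1 : nat) := State {
  st0 : 'cV[R]_n0;
  st1 : R -> 'cV[R]_n1;
  st2 : R -> 'cV[R]_n1 }.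

Section Space.
Variables (R : realType) (n0 n1 : nat) (a b c d : R).

Definition in_RL2 (u : state R n0 n1) : Prop :=
  square_integrable a b (st1 u) /\ square_integrable c d (st2 u).

(* Equality of the elements represented by [u] and [v]. *)
Definition RL2_eq (u v : state R n0 n1) : Prop :=
  [/\ st0 u = st0 v, ae_eq_on a b (st1 u) (st1 v)
    & ae_eq_on c d (st2 u) (st2 v)].

End Space.

(* The arguments of [Qxy] and [Qyx] are both in the order (x, y). *)
Record params011 (R : realType) (n0 n1 : nat) := Params011 {
  Q00 : 'M[R]_n0;
  Q0x : R -> 'M[R]_(n0, n1);
  Q0y : R -> 'M[R]_(n0, n1);
  Qx0 : R -> 'M[R]_(n1, n0);
  Qy0 : R -> 'M[R]_(n1, n0);
  Qxx0 : R -> 'M[R]_n1;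
  Qxx1 : R -> R -> 'M[R]_n1;
  Qxx2 : R -> R -> 'M[R]_n1;
  Qxy : R -> R -> 'M[R]_n1;
  Qyx : R -> R -> 'M[R]_n1;
  Qyy0 : R -> 'M[R]_n1;
  Qyy1 : R -> R -> 'M[R]_n1;
  Qyy2 : R -> R -> 'M[R]_n1 }.

Section Params.
Variables (R : realType) (n0 n1 : nat) (a b c d : R).

Definition polynomial_params (Q : params011 R n0 n1) : Prop :=
  [/\ polynomial_on a b (Q0x Q) /\ polynomial_on c d (Q0y Q),
      polynomial_on a b (Qx0 Q) /\ polynomial_on c d (Qy0 Q),
      [/\ polynomial_on a b (Qxx0 Q), polynomial2_on a b a b (Qxx1 Q)
        & polynomial2_on a b a b (Qxx2 Q)],
      polynomial2_on a b c d (Qxy Q) /\ polynomial2_on a b c d (Qyx Q)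
    & [/\ polynomial_on c d (Qyy0 Q), polynomial2_on c d c d (Qyy1 Q)
        & polynomial2_on c d c d (Qyy2 Q)]].

Definition separable_params (Q : params011 R n0 n1) : Prop :=
  (forall x t, x \in `[a, b] -> t \in `[a, b] -> Qxx2 Q x t = Qxx1 Q x t) /\
  (forall y v, y \in `[c, d] -> v \in `[c, d] -> Qyy2 Q y v = Qyy1 Q y v).

(* The 011-PI operator of separable parameters: as [Qxx2] and [Qyy2] agree
   with [Qxx1] and [Qyy1], each of the two pairs contributes one integral over
   the whole interval. *)
Definition PI_op (Q : params011 R n0 n1) (u : state R n0 n1) :
    state R n0 n1 :=
  State
    (Q00 Q *m st0 u
     + mxint a b (fun x => Q0x Q x *m st1 u x)
     + mxint c d (fun y => Q0y Q y *m st2 u y))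
    (fun x =>
       Qx0 Q x *m st0 u
       + Qxx0 Q x *m st1 u x
       + mxint a b (fun t => Qxx1 Q x t *m st1 u t)
       + mxint c d (fun y => Qxy Q x y *m st2 u y))
    (fun y =>
       Qy0 Q y *m st0 u
       + mxint a b (fun x => Qyx Q x y *m st1 u x)
       + Qyy0 Q y *m st2 u y
       + mxint c d (fun v => Qyy1 Q y v *m st2 u v)).

End Params.

Record separation (R : realType) (n0 n1 q : nat) := Separation {
  Z : R -> 'M[R]_(q, n1);
  H0x : 'M[R]_(n0, q);
  H0y : 'M[R]_(n0, q);
  Hx0 : 'M[R]_(q, n0);
  Hy0 : 'M[R]_(q, n0);
  Gxx : 'M[R]_q;
  Gxy : 'M[R]_q;
  Gyx : 'M[R]_q;
  Gyy : 'M[R]_q }.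

Section Inverse.
Variables (R : realType) (n0 n1 q : nat) (a b c d : R).
Variables (Q : params011 R n0 n1) (S : separation R n0 n1 q).

Definition separates : Prop :=
  [/\ (forall x, x \in `[a, b] -> Q0x Q x = H0x S *m Z S x) /\
      (forall y, y \in `[c, d] -> Q0y Q y = H0y S *m Z S y),
      (forall x, x \in `[a, b] -> Qx0 Q x = (Z S x)^T *m Hx0 S) /\
      (forall y, y \in `[c, d] -> Qy0 Q y = (Z S y)^T *m Hy0 S),
      (forall x t, x \in `[a, b] -> t \in `[a, b] ->
        Qxx1 Q x t = (Z S x)^T *m Gxx S *m Z S t) /\
      (forall x y, x \in `[a, b] -> y \in `[c, d] ->
        Qxy Q x y = (Z S x)^T *m Gxy S *m Z S y)
    & (forall x y, x \in `[a, b] -> y \in `[c, d] ->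
        Qyx Q x y = (Z S y)^T *m Gyx S *m Z S x) /\
      (forall y v, y \in `[c, d] -> v \in `[c, d] ->
        Qyy1 Q y v = (Z S y)^T *m Gyy S *m Z S v)].

Definition hQxx0 (x : R) : 'M[R]_n1 := invmx (Qxx0 Q x).
Definition hQyy0 (y : R) : 'M[R]_n1 := invmx (Qyy0 Q y).

Definition Kxx : 'M[R]_q := mxint a b (fun x => Z S x *m hQxx0 x *m (Z S x)^T).
Definition Kyy : 'M[R]_q := mxint c d (fun y => Z S y *m hQyy0 y *m (Z S y)^T).

Let iQ00 : 'M[R]_n0 := invmx (Q00 Q).

Definition Pixx : 'M[R]_q := Gxx S - Hx0 S *m iQ00 *m H0x S.
Definition Pixy : 'M[R]_q := Gxy S - Hx0 S *m iQ00 *m H0y S.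
Definition Piyx : 'M[R]_q := Gyx S - Hy0 S *m iQ00 *m H0x S.
Definition Piyy : 'M[R]_q := Gyy S - Hy0 S *m iQ00 *m H0y S.

Definition Sigx : 'M[R]_q := 1%:M + Kxx *m Pixx.
Definition Sigy : 'M[R]_q := 1%:M + Kyy *m Piyy.

Definition Exy : 'M[R]_q := invmx Sigx *m Kxx *m Pixy.
Definition Eyx : 'M[R]_q := invmx Sigy *m Kyy *m Piyx.

Definition Schx : 'M[R]_q := Sigx - Kxx *m Pixy *m Eyx.
Definition Schy : 'M[R]_q := Sigy - Kyy *m Piyx *m Exy.

Definition hGyx : 'M[R]_q := - ((Piyx - Piyy *m Eyx) *m invmx Schx).
Definition hGxy : 'M[R]_q := - ((Pixy - Pixx *m Exy) *m invmx Schy).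
Definition hGyy : 'M[R]_q := - ((Piyy + hGyx *m Kxx *m Pixy) *m invmx Sigy).
Definition hGxx : 'M[R]_q := - ((Pixx + hGxy *m Kyy *m Piyx) *m invmx Sigx).

Definition hHy0 : 'M[R]_(q, n0) :=
  - ((Hy0 S + hGyy *m Kyy *m Hy0 S + hGyx *m Kxx *m Hx0 S) *m iQ00).
Definition hHx0 : 'M[R]_(q, n0) :=
  - ((Hx0 S + hGxx *m Kxx *m Hx0 S + hGxy *m Kyy *m Hy0 S) *m iQ00).
Definition hH0y : 'M[R]_(n0, q) :=
  - ((iQ00 *m H0y S - iQ00 *m H0x S *m Exy) *m invmx Schy).
Definition hH0x : 'M[R]_(n0, q) :=
  - ((iQ00 *m H0x S + hH0y *m Kyy *m Piyx) *m invmx Sigx).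

Definition hQ00 : 'M[R]_n0 :=
  (1%:M - hH0x *m Kxx *m Hx0 S - hH0y *m Kyy *m Hy0 S) *m iQ00.

Let hQxx1 (x t : R) : 'M[R]_n1 :=
  hQxx0 x *m (Z S x)^T *m hGxx *m Z S t *m hQxx0 t.
Let hQyy1 (y v : R) : 'M[R]_n1 :=
  hQyy0 y *m (Z S y)^T *m hGyy *m Z S v *m hQyy0 v.

Definition Linv : params011 R n0 n1 := {|
  Q00 := hQ00;
  Q0x := fun x => hH0x *m Z S x *m hQxx0 x;
  Q0y := fun y => hH0y *m Z S y *m hQyy0 y;
  Qx0 := fun x => hQxx0 x *m (Z S x)^T *m hHx0;
  Qy0 := fun y => hQyy0 y *m (Z S y)^T *m hHy0;
  Qxx0 := hQxx0;
  Qxx1 := hQxx1;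
  Qxx2 := hQxx1;
  Qxy := fun x y => hQxx0 x *m (Z S x)^T *m hGxy *m Z S y *m hQyy0 y;
  Qyx := fun x y => hQyy0 y *m (Z S y)^T *m hGyx *m Z S x *m hQxx0 x;
  Qyy0 := hQyy0;
  Qyy1 := hQyy1;
  Qyy2 := hQyy1 |}.

End Inverse.

(* Main.v *)
(* Apart from multiplication by Qxx0 and Qyy0, P[Q] u depends on u only
   through the finite vector xi = (u0, int Z u1, int Z u2).  It has the form u |-> (U xi, D1 u1 + L1 v1, D2 u2 + L2 v2) with (v1, v2) = V xi, and
   P[Q^] has the same form with matrices U^, V^.  The vector of the second
   operator at P[Q] u is X xi, with X = [U; K V + [0 1]] and
   K = diag(Kxx, Kyy), so that P[Q^] P[Q] = 1 amounts to the matrix identities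
   U^ X = [1 0] and V^ X = - V.  The formulas defining Q^ are the solution of
   this linear system by two Schur complements.  The identities also give
   X^ X = 1 for the matrix X^ built from U^ and V^; hence X X^ = 1, from which
   the identities with the roles of Q and Q^ exchanged follow, even when K is
   singular. *)
Require Import Defs.
From mathcomp Require Import all_boot all_order all_algebra.
From mathcomp Require Import all_classical all_reals all_analysis.
From mathcomp Require Import measurable_realfun.
Set Implicit Arguments.
Unset Strict Implicit.
Unset Printing Implicit Defensive.

Import Order.TTheory GRing.Theory Num.Theory.
Import numFieldNormedType.Exports.
Local Open Scope classical_set_scope.
Local Open Scope ring_scope.

(** * Scalar functions *)

Section ScalarFunctions.
Variable R : realType.
Local Notation mu := (@lebesgue_measure R).
Implicit Types (s t : R) (f g : R -> R).

(** Domination gives [|f|^r <= |g|^r] pointwise, so the integral defining the norm of [f] is bounded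
    by the finite one of [g]. *)
Lemma le_Lfun (r : R) f g : 1 <= r -> measurable_fun setT f ->
  (forall x, `|f x| <= `|g x|) -> g \in Lfun mu r%:E -> f \in Lfun mu r%:E.
Proof.
move=> r1 mf fg gL; have r0 : 0 <= r by exact: le_trans ler01 r1.
have mg : measurable_fun setT g by move: gL => /andP[/[!inE]].
have mpow (h : R -> R) : measurable_fun setT h ->
    measurable_fun setT (fun x => `|h x| `^ r).
  move=> mh.
  apply: (@measurableT_comp _ _ _ _ _ _ (@powR R ^~ r)) => //.
  exact: measurableT_comp.
apply/andP; split; rewrite inE //= /finite_norm unlock /Lnorm poweR_lty//=.
have /integrableP[_ goo] := Lfun_integrable r1 gL; apply: le_lt_trans goo.
rewrite ge0_le_integral//=.
- by apply/measurable_EFinP; exact: mpow.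
- by apply/measurable_EFinP; apply: measurableT_comp => //; exact: mpow.
- move=> x _; rewrite lee_fin [leRHS]ger0_norm ?powR_ge0//.
  by rewrite ge0_ler_powR ?nnegrE.
Qed.

Lemma eq_restrict s t f g : {in `[s, t], f =1 g} ->
  f \_ `[s, t] = g \_ `[s, t].
Proof.
move=> fg; apply/funext => x; rewrite /patch; case: ifPn => // xst.
by apply: fg; move: xst; rewrite inE.
Qed.

(** A continuous [f] is bounded on the compact segment by some [M], so the product is dominated by
    [M * g]. *)
Lemma L2_mul_continuous s t f g : {within `[s, t], continuous f} ->
  g \_ `[s, t] \in Lfun mu 2%:E -> (f \* g) \_ `[s, t] \in Lfun mu 2%:E.
Proof.
move=> cf gL.
have mst : measurable `[s, t]%classic by exact: measurable_itv.
have mg : measurable_fun `[s, t] g.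
  by apply/measurable_restrictT => //; move: gL => /andP[/[!inE]].
have [M fM] : exists M : R, forall x, x \in `[s, t] -> `|f x| <= M.
  have /compact_bounded[N [_ fN]] :=
    continuous_compact cf (@segment_compact R s t).
  (* Boundedness provides a bound by every real strictly above [N]; [N + 1] is one. *)
  exists (N + 1) => x xst; apply: (fN (N + 1)); first by rewrite ltrDl.
  by exists x.
apply: (@le_Lfun 2 _ (M \o* (g \_ `[s, t]))).
- by rewrite ler1n.
- apply/(measurable_restrictT _ mst); apply: measurable_funM => //.
  exact: subspace_continuous_measurable_fun.
- move=> x; rewrite /patch /= [leRHS]normrM; case: ifPn => [|_]; last first.
    by rewrite normr0 mul0r.
  rewrite inE /= => xst; rewrite normrM mulrC ler_wpM2l//.
  by rewrite (le_trans (fM _ xst)) ?ler_norm.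
- by apply: Lfun_scale; rewrite ?ler1n.
Qed.

(** Hoelder's inequality with exponents 2 and 2, applied to the extensions by zero, whose product is
    the extension of the product. *)
Lemma L2_mul_integrable s t f g : f \_ `[s, t] \in Lfun mu 2%:E ->
  g \_ `[s, t] \in Lfun mu 2%:E ->
  mu.-integrable `[s, t] (EFin \o (f \* g)).
Proof.
move=> fL gL; apply/integrable_mkcond; first exact: measurable_itv.
have /Lfun1_integrable := Lfun2_mul_Lfun1 fL gL.
congr (_.-integrable _ _); apply/funext => x /=; rewrite /patch.
by case: ifPn => //; rewrite mulr0.
Qed.

Lemma Rintegral_sum s t (I : Type) (r : seq I) (f : I -> R -> R) :
  (forall i, mu.-integrable `[s, t] (EFin \o f i)) ->
  Rintegral mu `[s, t] (fun x => \sum_(i <- r) f i x) =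
  \sum_(i <- r) Rintegral mu `[s, t] (f i).
Proof.
move=> fi; rewrite /Rintegral; under eq_integral do rewrite -sumEFin.
rewrite (integral_sum _ fi)//; rewrite sum_fine// => i _.
by apply: (integrable_fin_num _ (fi i)); exact: measurable_itv.
Qed.

Lemma continuous_ratio s t (p r : {poly R}) :
  (forall x, x \in `[s, t] -> r.[x] != 0) ->
  {within `[s, t], continuous (fun x => p.[x] / r.[x])}.
Proof.
move=> r0; apply: continuous_in_subspaceT => x; rewrite inE /= => xst.
apply: cvgM; first exact: continuous_horner.
by apply: cvgV; [exact: r0|exact: continuous_horner].
Qed.

End ScalarFunctions.

(** * Matrix-valued functions *)

Section MatrixFunctions.
Variable R : realType.
Local Notation mu := (@lebesgue_measure R).
Implicit Types s t : R.

Definition mxintegrable m n s t (F : R -> 'M[R]_(m, n)) : Prop :=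
  forall i j, mu.-integrable `[s, t] (EFin \o (fun x => F x i j)).

Definition mxcontinuous m n s t (F : R -> 'M[R]_(m, n)) : Prop :=
  forall i j, {within `[s, t], continuous (fun x => F x i j)}.

Lemma eq_mxint m n s t (F G : R -> 'M[R]_(m, n)) : {in `[s, t], F =1 G} ->
  mxint s t F = mxint s t G.
Proof.
move=> FG; apply/matrixP => i j; rewrite !mxE; apply: eq_Rintegral => x.
by rewrite inE /= => xst; rewrite FG.
Qed.

Lemma mxintD m n s t (F G : R -> 'M[R]_(m, n)) :
  mxintegrable s t F -> mxintegrable s t G ->
  mxint s t (fun x => F x + G x) = mxint s t F + mxint s t G.
Proof.
move=> iF iG; apply/matrixP => i j; rewrite !mxE.
rewrite -(RintegralD _ (iF i j) (iG i j)); last exact: measurable_itv.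
by apply: eq_Rintegral => x _; rewrite mxE.
Qed.

Lemma mxint_mull m n p s t (A : 'M[R]_(m, n)) (F : R -> 'M[R]_(n, p)) :
  mxintegrable s t F -> mxint s t (fun x => A *m F x) = A *m mxint s t F.
Proof.
move=> iF; apply/matrixP => i j; rewrite !mxE.
under [LHS]eq_Rintegral do rewrite mxE.
rewrite Rintegral_sum => [|k]; last first.
  by apply: (integrableZl _ (A i k) (iF k j)); exact: measurable_itv.
apply: eq_bigr => k _; rewrite mxE; exact: RintegralZl.
Qed.

Lemma mxint_tr m n s t (F : R -> 'M[R]_(m, n)) :
  mxint s t (fun x => (F x)^T) = (mxint s t F)^T.
Proof.
apply/matrixP => i j; rewrite !mxE.
by apply: eq_Rintegral => x _; rewrite mxE.
Qed.

Lemma mxint_mulr m n p s t (F : R -> 'M[R]_(m, n)) (A : 'M[R]_(n, p)) :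
  mxintegrable s t F -> mxint s t (fun x => F x *m A) = mxint s t F *m A.
Proof.
(* Transposition turns right multiplication into left multiplication. *)
move=> iF; apply: trmx_inj; rewrite trmx_mul -!mxint_tr -mxint_mull.
  by apply: eq_mxint => x _; rewrite trmx_mul.
move=> i j; move: (iF j i); congr (_.-integrable _ _).
by apply/funext => x /=; rewrite mxE.
Qed.

Lemma eq_square_integrable m n s t (F G : R -> 'M[R]_(m, n)) :
  {in `[s, t], F =1 G} -> square_integrable s t F -> square_integrable s t G.
Proof.
move=> FG iF i j; rewrite -(@eq_restrict _ _ _ (fun x => F x i j)) ?iF//.
by move=> x xst; rewrite FG.
Qed.

Lemma square_integrableD m n s t (F G : R -> 'M[R]_(m, n)) :
  square_integrable s t F -> square_integrable s t G ->
  square_integrable s t (fun x => F x + G x).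
Proof.
move=> iF iG i j.
suff -> : (fun x => (F x + G x) i j) \_ `[s, t] =
    ((fun x => F x i j) \_ `[s, t]) + ((fun x => G x i j) \_ `[s, t]).
  exact: (Lfun_addr_closed mu (lee1n 2)).2.
apply/funext => x; rewrite fctE /patch.
by case: ifPn => _; rewrite ?mxE ?addr0.
Qed.

Lemma square_integrable_sum m n s t (I : Type) (r : seq I)
    (F : I -> R -> 'M[R]_(m, n)) :
  (forall i, square_integrable s t (F i)) ->
  square_integrable s t (fun x => \sum_(i <- r) F i x).
Proof.
move=> iF; elim: r => [|k r ih].
  move=> i j; suff -> : (fun x => (\sum_(k <- [::]) F k x) i j) \_ `[s, t] = 0.
    exact: (Lfun_addr_closed mu (lee1n 2)).1.
  by apply/funext => x; rewrite /patch; case: ifPn => _ //; rewrite big_nil mxE.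
apply: eq_square_integrable (square_integrableD (iF k) ih) => x _ /=.
by rewrite big_cons.
Qed.

Lemma square_integrable_tr m n s t (F : R -> 'M[R]_(m, n)) :
  square_integrable s t F -> square_integrable s t (fun x => (F x)^T).
Proof.
move=> iF i j; rewrite -(@eq_restrict _ _ _ (fun x => F x j i)) ?iF//.
by move=> x _; rewrite mxE.
Qed.

Lemma square_integrable_continuous_mull m n p s t (A : R -> 'M[R]_(m, n))
    (F : R -> 'M[R]_(n, p)) :
  mxcontinuous s t A -> square_integrable s t F ->
  square_integrable s t (fun x => A x *m F x).
Proof.
move=> cA iF.
(* The matrix product is split into a sum over the inner index [k], so that each entry of a summand
   is a single scalar product. *)
apply: (@eq_square_integrable _ _ _ _
  (fun x => \sum_k \matrix_(i, j) (A x i k * F x k j))) => [x _|].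
  apply/matrixP => i j; rewrite summxE mxE.
  by apply: eq_bigr => k _; rewrite mxE.
apply: square_integrable_sum => k i j.
rewrite (@eq_restrict _ _ _ _ ((fun x => A x i k) \* (fun x => F x k j))).
  exact: L2_mul_continuous.
by move=> x _; rewrite mxE.
Qed.

Lemma mxcontinuous_cst m n s t (A : 'M[R]_(m, n)) : mxcontinuous s t (fun=> A).
Proof. by move=> i j; apply: continuous_subspaceT => x; exact: cvg_cst. Qed.

Lemma square_integrable_continuous_mulr m n p s t (F : R -> 'M[R]_(m, n))
    (A : R -> 'M[R]_(n, p)) :
  mxcontinuous s t A -> square_integrable s t F ->
  square_integrable s t (fun x => F x *m A x).
Proof.
move=> cA /square_integrable_tr iF.
have cAT : mxcontinuous s t (fun x => (A x)^T).
  move=> i j; apply: (@subspace_eq_continuous _ _ _ (fun x => A x j i)).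
    by move=> x _; rewrite /from_subspace mxE.
  exact: cA.
have /square_integrable_tr := square_integrable_continuous_mull cAT iF.
by apply: eq_square_integrable => x _ /=; rewrite trmx_mul !trmxK.
Qed.

Lemma square_integrable_mul m n p s t (F : R -> 'M[R]_(m, n))
    (G : R -> 'M[R]_(n, p)) :
  square_integrable s t F -> square_integrable s t G ->
  mxintegrable s t (fun x => F x *m G x).
Proof.
move=> iF iG i j.
have : mu.-integrable `[s, t]
    (fun x => (\sum_k (F x i k * G x k j)%:E)%E).
  apply: integrable_sum => [|k _]; first exact: measurable_itv.
  exact: L2_mul_integrable.
congr (_.-integrable _ _); apply/funext => x /=.
by rewrite mxE sumEFin.
Qed.

Lemma mxcontinuous_polynomial m n s t (F : R -> 'M[R]_(m, n)) :
  polynomial_on s t F -> mxcontinuous s t F.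
Proof.
move=> [P FP] i j.
apply: (@subspace_eq_continuous _ _ _ (fun x => (P i j).[x] / 1.[x])).
  move=> x; rewrite inE /from_subspace /= => xst.
  by rewrite FP// mxE hornerC divr1.
by apply: continuous_ratio => x _; rewrite hornerC oner_neq0.
Qed.

(** Cramer's rule: the entries of the inverse are those of the adjugate over the determinant, ratios
    of polynomials whose denominator does not vanish on the segment. *)
Lemma mxcontinuous_inv n s t (F : R -> 'M[R]_n) :
  polynomial_on s t F -> (forall x, x \in `[s, t] -> F x \in unitmx) ->
  mxcontinuous s t (fun x => invmx (F x)).
Proof.
move=> [P FP] uF i j.
have FE x : x \in `[s, t] -> F x = map_mx (horner_eval x) P.
  by move=> xst; rewrite FP//; apply/matrixP => k l; rewrite !mxE.
have detF x : x \in `[s, t] -> \det (F x) = (\det P).[x].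
  by move=> xst; rewrite FE// det_map_mx.
apply: (@subspace_eq_continuous _ _ _
  (fun x => ((\adj P) i j).[x] / (\det P).[x])).
  move=> x; rewrite inE /from_subspace /= => xst.
  rewrite /invmx uF// mxE detF// FE// -map_mx_adj.
  by rewrite !mxE mulrC.
apply: continuous_ratio => x xst; rewrite -detF//.
by have := uF _ xst; rewrite unitmxE unitfE.
Qed.

End MatrixFunctions.

(** * Block elimination *)

Section Elimination.
Variables (F : fieldType) (n q : nat).
Variables (A : 'M[F]_n) (Hx Hy : 'M[F]_(n, q)) (Bx By : 'M[F]_(q, n)).
Variables (Cxx Cxy Cyx Cyy Kx Ky : 'M[F]_q).

(** The two conclusions are a linear system in the rows [hx], [hy]. The first is solved for [hx] by
    inverting [Sx]; substitution in the second leaves [hy] times the Schur complement of [Sx]. *)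
Lemma schur_row_solve p (Sx Sy Mxy Myx : 'M[F]_q) (rx ry hx hy : 'M[F]_(p, q)) :
  Sx \in unitmx -> Sy - Ky *m Myx *m (invmx Sx *m Kx *m Mxy) \in unitmx ->
  hx = - ((rx + hy *m Ky *m Myx) *m invmx Sx) ->
  hy = - ((ry - rx *m (invmx Sx *m Kx *m Mxy)) *m
          invmx (Sy - Ky *m Myx *m (invmx Sx *m Kx *m Mxy))) ->
  rx + hx *m Sx + hy *m Ky *m Myx = 0 /\
  ry + hx *m Kx *m Mxy + hy *m Sy = 0.
Proof.
set E := invmx Sx *m Kx *m Mxy => uSx uSchur hxE hyE; split.
  by rewrite hxE mulNmx mulmxKV// opprD addrA subrr sub0r addNr.
(* This is the formula for [hy] multiplied by the Schur complement. *)
have hySy : hy *m Sy = hy *m Ky *m Myx *m E - (ry - rx *m E).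
  rewrite -[Sy](subrK (Ky *m Myx *m E)) mulmxDr {1}hyE mulNmx mulmxKV//.
  by rewrite addrC !mulmxA.
have -> : hx *m Kx *m Mxy = - (rx *m E + hy *m Ky *m Myx *m E).
  by rewrite -mulmxDl hxE !mulNmx /E !mulmxA.
by rewrite hySy opprB opprD !addrA !subrK subrr.
Qed.

Let U := row_mx A (row_mx Hx Hy).
Let V := col_mx (row_mx Bx (row_mx Cxx Cxy)) (row_mx By (row_mx Cyx Cyy)).
Let X := col_mx U (block_mx Kx 0 0 Ky *m V + row_mx 0 1%:M).

(** The first block column determines [h0]. Inserting it in the other two replaces each [C] by its
    Schur complement [C - B A^-1 H] (the matrices [Pi]) and leaves a system for [hx], [hy] of the
    shape treated by [schur_row_solve]. *)
Lemma block_row_solve p (e h0 : 'M[F]_(p, n)) (fx fy hx hy : 'M[F]_(p, q)) :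
  A \in unitmx ->
  h0 = (e - (hx *m Kx *m Bx) - hy *m Ky *m By) *m invmx A ->
  e *m invmx A *m Hx - fx + hx *m (1%:M + Kx *m (Cxx - Bx *m invmx A *m Hx))
    + hy *m Ky *m (Cyx - By *m invmx A *m Hx) = 0 ->
  e *m invmx A *m Hy - fy + hx *m Kx *m (Cxy - Bx *m invmx A *m Hy)
    + hy *m (1%:M + Ky *m (Cyy - By *m invmx A *m Hy)) = 0 ->
  row_mx h0 (row_mx hx hy) *m X = row_mx e (row_mx fx fy).
Proof.
move=> uA h0E eqx eqy.
rewrite /X /U /V mul_row_col mulmxDr mulmxA mul_row_block !mulmx0 addr0 add0r.
rewrite mul_row_col !mul_mx_row mulmx0 mulmx1 !add_row_mx addr0.
have h0M m (M : 'M[F]_(n, m)) : h0 *m M = e *m invmx A *m M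
    - hx *m Kx *m Bx *m invmx A *m M - hy *m Ky *m By *m invmx A *m M.
  by rewrite h0E !mulmxBl.
congr row_mx; [|congr row_mx].
- by rewrite h0E mulmxKV// addrA addrAC subrK subrK.
- apply/eqP; rewrite -subr_eq0 -[X in _ == X]eqx; apply/eqP.
  rewrite h0M !mulmxDr !mulmxN !mulmx1 !mulmxA.
  (* Summands 1 to 3 come from [h0], 4 and 5 from [K V], 6 from the identity block, and 7 is [- fx];
     they are grouped by the factors [e], [hx] and [hy]. *)
  by rewrite [LHS](AC (3*3*1) ((1*7)*(6*(4*2))*(5*3))).
- apply/eqP; rewrite -subr_eq0 -[X in _ == X]eqy; apply/eqP.
  rewrite h0M !mulmxDr !mulmxN !mulmx1 !mulmxA.
  by rewrite [LHS](AC (3*3*1) ((1*7)*(4*2)*(6*(5*3)))).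
Qed.

End Elimination.

(** In [X' X] the term [K V' X = - K V] cancels [K V] in the lower rows, so [X' X = 1]; for square
    matrices this gives [X X' = 1]. *)
Lemma block_inverse_swap (F : fieldType) n k (U U' : 'M[F]_(n, n + k))
    (V V' : 'M[F]_(k, n + k)) (K : 'M[F]_k) :
  U' *m col_mx U (K *m V + row_mx 0 1%:M) = row_mx 1%:M 0 ->
  V' *m col_mx U (K *m V + row_mx 0 1%:M) = - V ->
  U *m col_mx U' (K *m V' + row_mx 0 1%:M) = row_mx 1%:M 0 /\
  V *m col_mx U' (K *m V' + row_mx 0 1%:M) = - V'.
Proof.
set X := col_mx U _; set X' := col_mx U' _ => UX VX.
have X'X : X' *m X = 1%:M.
  rewrite mul_col_mx UX mulmxDl -mulmxA VX mulmxN {1}/X mul_row_col mul0mx.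
  by rewrite add0r mul1mx addKr [RHS]scalar_mx_block.
have XX' : X *m X' = 1%:M by exact: mulmx1C.
(* The lower rows of [X X' = 1] give the second identity only after multiplication by [K]; it is
   obtained instead by multiplying [V' X = - V] by [X'] on the right. *)
split; last by apply: oppr_inj; rewrite opprK -mulNmx -VX -mulmxA XX' mulmx1.
have : usubmx (X *m X') = usubmx 1%:M by rewrite XX'.
by rewrite mul_col_mx col_mxKu scalar_mx_block /block_mx col_mxKu.
Qed.

(** * Operators of low rank modulo multiplication operators *)

Section LowRankOperators.
Variables (R : realType) (n0 n1 q : nat) (a b c d : R).

(* Represents the operator [u |-> (U xi, D1 u1 + L1 v1, D2 u2 + L2 v2)], where
   [xi = (u0, int R1 u1, int R2 u2)] and [(v1, v2) = V xi]. *)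
Record lowrank := LowRank {
  lrD1 : R -> 'M[R]_n1;
  lrL1 : R -> 'M[R]_(n1, q);
  lrR1 : R -> 'M[R]_(q, n1);
  lrD2 : R -> 'M[R]_n1;
  lrL2 : R -> 'M[R]_(n1, q);
  lrR2 : R -> 'M[R]_(q, n1);
  lrU : 'M[R]_(n0, n0 + (q + q));
  lrV : 'M[R]_(q + q, n0 + (q + q)) }.

Implicit Types (F G : lowrank) (u v : state R n0 n1).

Definition lr_coords F u : 'cV[R]_(n0 + (q + q)) :=
  col_mx (st0 u)
    (col_mx (mxint a b (fun x => lrR1 F x *m st1 u x))
            (mxint c d (fun y => lrR2 F y *m st2 u y))).

Definition lr_op F u : state R n0 n1 :=
  State (lrU F *m lr_coords F u)
    (fun x => lrD1 F x *m st1 u x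
              + lrL1 F x *m usubmx (lrV F *m lr_coords F u))
    (fun y => lrD2 F y *m st2 u y
              + lrL2 F y *m dsubmx (lrV F *m lr_coords F u)).

(** Continuity makes multiplication by [D1], [D2] preserve square integrability; the remaining
    conditions make all pairings with [R1], [R2] integrable. *)
Definition lr_regular F : Prop :=
  [/\ mxcontinuous a b (lrD1 F), mxcontinuous c d (lrD2 F),
      square_integrable a b (lrL1 F) /\ square_integrable a b (lrR1 F)
    & square_integrable c d (lrL2 F) /\ square_integrable c d (lrR2 F)].

(* The diagonal and low-rank functions of [G] invert those of [F]; nothing is
   said about [lrU G] and [lrV G]. *)
Definition lr_dual F G (Kx Ky : 'M[R]_q) : Prop :=
  [/\ {in `[a, b], forall x, [/\ lrD1 G x *m lrD1 F x = 1%:M,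
         lrD1 G x *m lrL1 F x = lrL1 G x & lrR1 G x *m lrD1 F x = lrR1 F x]},
      {in `[c, d], forall y, [/\ lrD2 G y *m lrD2 F y = 1%:M,
         lrD2 G y *m lrL2 F y = lrL2 G y & lrR2 G y *m lrD2 F y = lrR2 F y]},
      mxint a b (fun x => lrR1 G x *m lrL1 F x) = Kx
    & mxint c d (fun y => lrR2 G y *m lrL2 F y) = Ky].

(** Equality at every point of the intervals, stronger than [RL2_eq]: the representatives produced
    by the formulas agree pointwise, so null sets enter only at the end. *)
Definition state_eq_on u v : Prop :=
  [/\ st0 u = st0 v, {in `[a, b], st1 u =1 st1 v}
    & {in `[c, d], st2 u =1 st2 v}].

Lemma state_eq_on_sym u v : state_eq_on u v -> state_eq_on v u.
Proof.
by move=> [e0 e1 e2]; split=> // x xst; rewrite ?e1 ?e2.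
Qed.

Lemma state_eq_on_trans v u w :
  state_eq_on u v -> state_eq_on v w -> state_eq_on u w.
Proof.
move=> [u0 u1 u2] [v0 v1 v2]; split=> [|x xst|x xst]; first by rewrite u0.
  by rewrite u1// v1.
by rewrite u2// v2.
Qed.

Lemma state_eq_on_RL2_eq u v : state_eq_on u v -> RL2_eq a b c d u v.
Proof. by move=> [e0 e1 e2]; split=> //; apply: aeW => x /=; auto. Qed.

Lemma state_eq_on_in_RL2 u v :
  state_eq_on u v -> in_RL2 a b c d u -> in_RL2 a b c d v.
Proof.
by move=> [_ e1 e2] [u1 u2]; split; [apply: eq_square_integrable u1
  |apply: eq_square_integrable u2].
Qed.

Lemma state_eq_on_lr_op F u v :
  state_eq_on u v -> state_eq_on (lr_op F u) (lr_op F v).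
Proof.
move=> [e0 e1 e2]; have e : lr_coords F u = lr_coords F v.
  rewrite /lr_coords e0; congr (col_mx _ (col_mx _ _)); apply: eq_mxint.
    by move=> x xst /=; rewrite e1.
  by move=> x xst /=; rewrite e2.
by split=> [|x xst|x xst] /=; rewrite e ?e1 ?e2.
Qed.

Lemma in_RL2_lr_op F u :
  lr_regular F -> in_RL2 a b c d u -> in_RL2 a b c d (lr_op F u).
Proof.
move=> [cD1 cD2 [L1 _] [L2 _]] [u1 u2].
split; apply: square_integrableD; try exact: square_integrable_continuous_mull.
  by apply: square_integrable_continuous_mulr => //; exact: mxcontinuous_cst.
by apply: square_integrable_continuous_mulr => //; exact: mxcontinuous_cst.
Qed.

(** One coordinate of the image under a low-rank operator: [T' D = T] recovers the old coordinate,
    and the pairing of [T'] with [L] yields a diagonal block of [K]. *)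
Lemma mxint_lowrank m (s t : R) (D : R -> 'M[R]_n1) (L : R -> 'M[R]_(n1, m))
    (T T' : R -> 'M[R]_(m, n1)) (f : R -> 'cV[R]_n1) (e : 'cV[R]_m) :
  square_integrable s t L -> square_integrable s t T ->
  square_integrable s t T' -> square_integrable s t f ->
  {in `[s, t], forall x, T' x *m D x = T x} ->
  mxint s t (fun x => T' x *m (D x *m f x + L x *m e)) =
  mxint s t (fun x => T x *m f x) + mxint s t (fun x => T' x *m L x) *m e.
Proof.
move=> iL iT iT' iF TD; rewrite -mxint_mulr; last exact: square_integrable_mul.
rewrite -mxintD.
- by apply: eq_mxint => x xst; rewrite mulmxDr !mulmxA TD.
- exact: square_integrable_mul.
have iLe : square_integrable s t (fun x => L x *m e).
  by apply: square_integrable_continuous_mulr => //; exact: mxcontinuous_cst.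
have := square_integrable_mul iT' iLe.
by under eq_fun do rewrite mulmxA.
Qed.

Lemma lr_coords_lr_op F G Kx Ky u :
  lr_regular F -> lr_regular G -> lr_dual F G Kx Ky -> in_RL2 a b c d u ->
  lr_coords G (lr_op F u) =
  col_mx (lrU F) (block_mx Kx 0 0 Ky *m lrV F + row_mx 0 1%:M)
    *m lr_coords F u.
Proof.
move=> [_ _ [L1 R1] [L2 R2]] [_ _ [_ R1'] [_ R2']] [d1 d2 <- <-] [u1 u2].
rewrite mul_col_mx mulmxDl -mulmxA; congr col_mx.
rewrite {2}/lr_coords mul_row_col mul0mx add0r mul1mx.
(* [V xi] is split into [(v1, v2)], so that the block diagonal matrix acts on each part
   separately. *)
rewrite -[lrV F *m lr_coords F u]vsubmxK mul_block_col !mul0mx addr0 add0r.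
rewrite add_col_mx; congr col_mx; rewrite addrC.
  by apply: mxint_lowrank => // x /d1[].
by apply: mxint_lowrank => // x /d2[].
Qed.

(** The second operator sees the coordinates [X xi]. Hence its first component is [[1 0] xi = u0],
    and its function components receive [- (v1, v2)], which cancels the terms [D^ L v = L^ v] left
    by the first operator. *)
Lemma lr_opK F G Kx Ky u :
  lr_regular F -> lr_regular G -> lr_dual F G Kx Ky ->
  let X := col_mx (lrU F) (block_mx Kx 0 0 Ky *m lrV F + row_mx 0 1%:M) in
  lrU G *m X = row_mx 1%:M 0 -> lrV G *m X = - lrV F ->
  in_RL2 a b c d u -> state_eq_on (lr_op G (lr_op F u)) u.
Proof.
move=> rF rG dFG X UX VX iu.
have cE := lr_coords_lr_op rF rG dFG iu; case: dFG => d1 d2 _ _.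
split=> [|x xst|x xst].
- by rewrite {1}/lr_op /= cE mulmxA UX mul_row_col mul1mx mul0mx addr0.
- rewrite {1}/lr_op /= cE mulmxA VX mulNmx linearN mulmxN mulmxDr !mulmxA.
  by have [-> -> _] := d1 _ xst; rewrite mul1mx addrK.
- rewrite {1}/lr_op /= cE mulmxA VX mulNmx linearN mulmxN mulmxDr !mulmxA.
  by have [-> -> _] := d2 _ xst; rewrite mul1mx addrK.
Qed.

(** Every integral kernel factors through [R1] or [R2] on the right, so each integral is a matrix
    times a coordinate of [xi]. The factors are left general so that the lemma serves both [Q] and
    its inverse. *)
Lemma PI_op_lowrank (Q : params011 R n0 n1) L1 R1 L2 R2
    (hx hy : 'M[R]_(n0, q)) (b_x b_y : 'M[R]_(q, n0))
    (cxx cxy cyx cyy : 'M[R]_q) u :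
  let F := LowRank (Qxx0 Q) L1 R1 (Qyy0 Q) L2 R2
    (row_mx (Q00 Q) (row_mx hx hy))
    (col_mx (row_mx b_x (row_mx cxx cxy)) (row_mx b_y (row_mx cyx cyy))) in
  lr_regular F ->
  {in `[a, b], forall x, Q0x Q x = hx *m R1 x /\ Qx0 Q x = L1 x *m b_x} ->
  {in `[c, d], forall y, Q0y Q y = hy *m R2 y /\ Qy0 Q y = L2 y *m b_y} ->
  {in `[a, b] &, forall x t, Qxx1 Q x t = L1 x *m cxx *m R1 t} ->
  {in `[a, b] & `[c, d], forall x y, Qxy Q x y = L1 x *m cxy *m R2 y /\
                                     Qyx Q x y = L2 y *m cyx *m R1 x} ->
  {in `[c, d] &, forall y z, Qyy1 Q y z = L2 y *m cyy *m R2 z} ->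
  in_RL2 a b c d u -> state_eq_on (PI_op a b c d Q u) (lr_op F u).
Proof.
move=> F [_ _ [_ /= iR1] [_ /= iR2]] Q0 Q0' Qxx Qm Qyy [u1 u2].
have i1 := square_integrable_mul iR1 u1.
have i2 := square_integrable_mul iR2 u2.
have I1 m (f : R -> 'M[R]_(m, n1)) A :
    {in `[a, b], forall x, f x = A *m R1 x} ->
    mxint a b (fun x => f x *m st1 u x) =
    A *m mxint a b (fun x => R1 x *m st1 u x).
  move=> fE; rewrite -mxint_mull//.
  by apply: eq_mxint => x xst; rewrite fE// mulmxA.
have I2 m (f : R -> 'M[R]_(m, n1)) A :
    {in `[c, d], forall x, f x = A *m R2 x} ->
    mxint c d (fun x => f x *m st2 u x) =
    A *m mxint c d (fun x => R2 x *m st2 u x).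
  move=> fE; rewrite -mxint_mull//.
  by apply: eq_mxint => x xst; rewrite fE// mulmxA.
split=> [|x xst|y yst] /=.
- rewrite !mul_row_col (I1 _ _ hx) => [|x /Q0[]//].
  by rewrite (I2 _ _ hy) ?addrA// => y /Q0'[].
- rewrite mul_col_mx col_mxKu !mul_row_col.
  rewrite (I1 _ _ (L1 x *m cxx)) => [|t tst]; last exact: Qxx.
  rewrite (I2 _ _ (L1 x *m cxy)) => [|y yst]; last by have [] := Qm _ _ xst yst.
  have [_ ->] := Q0 _ xst; rewrite !mulmxDr !mulmxA !addrA.
  by congr (_ + _ + _); exact: addrC.
- rewrite mul_col_mx col_mxKd !mul_row_col.
  rewrite (I1 _ _ (L2 y *m cyx)) => [|x xst]; last by have [] := Qm _ _ xst yst.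
  rewrite (I2 _ _ (L2 y *m cyy)) => [|z zst]; last exact: Qyy.
  have [_ ->] := Q0' _ yst; rewrite !mulmxDr !mulmxA !addrA.
  by rewrite [X in X + _ = _]addrC !addrA.
Qed.

End LowRankOperators.

(** * The inverse of a separable operator *)

Section Inversion.
Variables (R : realType) (n0 n1 q : nat) (a b c d : R).
Variables (Q : params011 R n0 n1) (S : separation R n0 n1 q).

Definition lr_direct : lowrank R n0 n1 q :=
  LowRank (Qxx0 Q) (fun x => (Z S x)^T) (Z S)
    (Qyy0 Q) (fun y => (Z S y)^T) (Z S)
    (row_mx (Q00 Q) (row_mx (H0x S) (H0y S)))
    (col_mx (row_mx (Hx0 S) (row_mx (Gxx S) (Gxy S)))
            (row_mx (Hy0 S) (row_mx (Gyx S) (Gyy S)))).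

(** The factors [L^ = D^ Z^T] and [R^ = Z D^], with [D^] the pointwise inverse, absorb the outer
    factors of the kernels of [Linv], leaving the constant hatted matrices. *)
Definition lr_inverse : lowrank R n0 n1 q :=
  LowRank (hQxx0 Q) (fun x => hQxx0 Q x *m (Z S x)^T)
    (fun x => Z S x *m hQxx0 Q x)
    (hQyy0 Q) (fun y => hQyy0 Q y *m (Z S y)^T)
    (fun y => Z S y *m hQyy0 Q y)
    (row_mx (hQ00 a b c d Q S) (row_mx (hH0x a b c d Q S) (hH0y a b c d Q S)))
    (col_mx (row_mx (hHx0 a b c d Q S)
                    (row_mx (hGxx a b c d Q S) (hGxy a b c d Q S)))
            (row_mx (hHy0 a b c d Q S)
                    (row_mx (hGyx a b c d Q S) (hGyy a b c d Q S)))).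

Lemma lr_inverse_mul :
  Q00 Q \in unitmx -> Sigx a b Q S \in unitmx -> Sigy c d Q S \in unitmx ->
  Schx a b c d Q S \in unitmx -> Schy a b c d Q S \in unitmx ->
  let X := col_mx (lrU lr_direct)
    (block_mx (Kxx a b Q S) 0 0 (Kyy c d Q S) *m lrV lr_direct
     + row_mx 0 1%:M) in
  lrU lr_inverse *m X = row_mx 1%:M 0 /\ lrV lr_inverse *m X = - lrV lr_direct.
Proof.
move=> u0 ux uy uSx uSy X.
(* For a row of [- V] as right-hand side, [e = - B] and [f = - G], so the constant term
   [e A^-1 H - f] is an entry of [Pi]. *)
have PiE (B : 'M[R]_(q, n0)) (H : 'M[R]_(n0, q)) G :
    - B *m invmx (Q00 Q) *m H - - G = G - B *m invmx (Q00 Q) *m H.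
  by rewrite opprK !mulNmx addrC.
(* Each block row of the inverse is one instance of the elimination, and the defining formulas are
   literally its solution, hence [erefl]. The last row exchanges the roles of [x] and [y]. *)
have [eH1 eH2] := schur_row_solve ux uSy
  (erefl (hH0x a b c d Q S)) (erefl (hH0y a b c d Q S)).
have [eGx1 eGx2] := schur_row_solve ux uSy
  (erefl (hGxx a b c d Q S)) (erefl (hGxy a b c d Q S)).
have [eGy1 eGy2] := schur_row_solve uy uSx
  (erefl (hGyy a b c d Q S)) (erefl (hGyx a b c d Q S)).
split.
  rewrite -row_mx0; apply: block_row_solve => //; rewrite mul1mx subr0.
    exact: eH1.
  exact: eH2.
rewrite mul_col_mx opp_col_mx !opp_row_mx; congr col_mx.
  apply: block_row_solve => //.
  - by rewrite -!opprD mulNmx.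
  - by rewrite PiE; exact: eGx1.
  - by rewrite PiE; exact: eGx2.
apply: block_row_solve => //.
- by rewrite -!opprD mulNmx addrAC.
- by rewrite PiE addrAC; exact: eGy2.
- by rewrite PiE addrAC; exact: eGy1.
Qed.

Lemma lr_direct_regular :
  polynomial_on a b (Qxx0 Q) -> polynomial_on c d (Qyy0 Q) ->
  square_integrable a b (Z S) -> square_integrable c d (Z S) ->
  lr_regular a b c d lr_direct.
Proof.
by move=> px py Zx Zy; split; [exact: mxcontinuous_polynomial..| |];
  split=> //; exact: square_integrable_tr.
Qed.

Lemma lr_inverse_regular :
  polynomial_on a b (Qxx0 Q) -> polynomial_on c d (Qyy0 Q) ->
  (forall x, x \in `[a, b] -> Qxx0 Q x \in unitmx) ->
  (forall y, y \in `[c, d] -> Qyy0 Q y \in unitmx) ->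
  square_integrable a b (Z S) -> square_integrable c d (Z S) ->
  lr_regular a b c d lr_inverse.
Proof.
move=> px py ux uy Zx Zy; have cx := mxcontinuous_inv px ux.
have cy := mxcontinuous_inv py uy; split=> //; split.
- exact/square_integrable_continuous_mull/square_integrable_tr.
- exact: square_integrable_continuous_mulr.
- exact/square_integrable_continuous_mull/square_integrable_tr.
- exact: square_integrable_continuous_mulr.
Qed.

Lemma lr_direct_dual :
  (forall x, x \in `[a, b] -> Qxx0 Q x \in unitmx) ->
  (forall y, y \in `[c, d] -> Qyy0 Q y \in unitmx) ->
  lr_dual a b c d lr_direct lr_inverse (Kxx a b Q S) (Kyy c d Q S).
Proof.
move=> ux uy; split=> // x xst.
  by split; rewrite /= /hQxx0 ?mulVmx ?mulmxKV ?ux.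
by split; rewrite /= /hQyy0 ?mulVmx ?mulmxKV ?uy.
Qed.

(** The same [Kxx] and [Kyy] serve in both directions, since [R^ L] and [R L^] are both
    [Z D^ Z^T]. *)
Lemma lr_inverse_dual :
  (forall x, x \in `[a, b] -> Qxx0 Q x \in unitmx) ->
  (forall y, y \in `[c, d] -> Qyy0 Q y \in unitmx) ->
  lr_dual a b c d lr_inverse lr_direct (Kxx a b Q S) (Kyy c d Q S).
Proof.
move=> ux uy; split=> [x xst|y yst||].
- by split; rewrite /= /hQxx0 ?mulmxV ?mulKVmx ?ux.
- by split; rewrite /= /hQyy0 ?mulmxV ?mulKVmx ?uy.
- by apply: eq_mxint => x _ /=; rewrite mulmxA.
- by apply: eq_mxint => y _ /=; rewrite mulmxA.
Qed.

Lemma PI_op_direct u :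
  separates a b c d Q S -> lr_regular a b c d lr_direct ->
  in_RL2 a b c d u ->
  state_eq_on a b c d (PI_op a b c d Q u) (lr_op a b c d lr_direct u).
Proof.
move=> [[s0x s0y] [sx0 sy0] [sxx sxy] [syx syy]] reg iu.
apply: PI_op_lowrank => //.
- by move=> x xst; rewrite s0x ?sx0.
- by move=> y yst; rewrite s0y ?sy0.
- by move=> x y xst yst; rewrite sxy ?syx.
Qed.

Lemma PI_op_inverse u :
  lr_regular a b c d lr_inverse -> in_RL2 a b c d u ->
  state_eq_on a b c d (PI_op a b c d (Linv a b c d Q S) u)
    (lr_op a b c d lr_inverse u).
Proof.
move=> reg iu; apply: (@PI_op_lowrank _ _ _ _ _ _ _ _ (Linv a b c d Q S)) => //.
- by move=> x _; rewrite /= mulmxA.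
- by move=> y _; rewrite /= mulmxA.
- by move=> x t _ _; rewrite /= !mulmxA.
- by move=> x y _ _; split; rewrite /= !mulmxA.
- by move=> y z _ _; rewrite /= !mulmxA.
Qed.

End Inversion.

Theorem lemma5 (R : realType) (n0 n1 q : nat) (a b c d : R)
    (Q : params011 R n0 n1) (S : separation R n0 n1 q)
    (ltab : a < b) (ltcd : c < d)
    (Qpoly : polynomial_params a b c d Q)
    (Qsep : separable_params a b c d Q)
    (ZL2x : square_integrable a b (Z S))
    (ZL2y : square_integrable c d (Z S))
    (QS : separates a b c d Q S)
    (unitQ00 : Q00 Q \in unitmx)
    (unitQxx0 : forall x, x \in `[a, b] -> Qxx0 Q x \in unitmx)
    (unitQyy0 : forall y, y \in `[c, d] -> Qyy0 Q y \in unitmx)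
    (unitSigx : Sigx a b Q S \in unitmx)
    (unitSigy : Sigy c d Q S \in unitmx)
    (unitSchx : Sigx a b Q S - Kxx a b Q S *m Pixy Q S *m Eyx c d Q S
                  \in unitmx)
    (unitSchy : Sigy c d Q S - Kyy c d Q S *m Piyx Q S *m Exy a b Q S
                  \in unitmx) :
  let P := PI_op a b c d Q in
  let Phat := PI_op a b c d (Linv a b c d Q S) in
  forall u : state R n0 n1, in_RL2 a b c d u ->
    [/\ in_RL2 a b c d (P u) /\ in_RL2 a b c d (Phat u),
        RL2_eq a b c d (Phat (P u)) u
      & RL2_eq a b c d (P (Phat u)) u].
Proof.
move=> P Phat u iu; case: Qpoly => _ _ [px _ _] _ [py _ _].
have rD := lr_direct_regular px py ZL2x ZL2y.
have rI := lr_inverse_regular px py unitQxx0 unitQyy0 ZL2x ZL2y.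
have PE v : in_RL2 a b c d v ->
    state_eq_on a b c d (P v) (lr_op a b c d (lr_direct Q S) v).
  exact: PI_op_direct.
have PhatE v : in_RL2 a b c d v ->
    state_eq_on a b c d (Phat v) (lr_op a b c d (lr_inverse a b c d Q S) v).
  exact: PI_op_inverse.
(* Both images stay in the space, so the low-rank form of each operator applies to the image under
   the other. *)
have iP : in_RL2 a b c d (P u).
  exact: (state_eq_on_in_RL2 (state_eq_on_sym (PE u iu)) (in_RL2_lr_op rD iu)).
have iPhat : in_RL2 a b c d (Phat u).
  exact: (state_eq_on_in_RL2 (state_eq_on_sym (PhatE u iu))
            (in_RL2_lr_op rI iu)).
have [UX VX] := lr_inverse_mul unitQ00 unitSigx unitSigy unitSchx unitSchy.
(* The identities for the opposite order of composition follow by pure matrix algebra. *)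
have [UX' VX'] := block_inverse_swap UX VX.
have dD := lr_direct_dual S unitQxx0 unitQyy0.
have dI := lr_inverse_dual S unitQxx0 unitQyy0.
split=> //; apply: state_eq_on_RL2_eq.
- apply: (state_eq_on_trans (PhatE _ iP)).
  apply: (state_eq_on_trans (state_eq_on_lr_op _ (PE u iu))).
  exact: lr_opK rD rI dD UX VX iu.
- apply: (state_eq_on_trans (PE _ iPhat)).
  apply: (state_eq_on_trans (state_eq_on_lr_op _ (PhatE u iu))).
  exact: lr_opK rI rD dI UX' VX' iu.
Qed.
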